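(* Let $k\geq 3$ be an integer and let $\mathcal{P}_{k}$ be the class of sparse paving matroids with at most $k$ circuit-hyperplanes. Then $\mathcal{P}_{k}$ is strongly fractal, that is, $\lim_{n\to\infty}\Gamma_{\mathcal{P}_{k}}(n)=1$.
   Context: A matroid is sparse paving if every non-spanning circuit is a hyperplane (matroids of rank or corank zero are vacuously sparse paving). For a minor-closed class $\mathcal{M}$ of matroids containing infinitely many matroids, let $m_{n}$ be the number of isomorphism classes of $n$-element matroids in $\mathcal{M}$, and $x_{n}$ the number of isomorphism classes of $n$-element excluded minors for $\mathcal{M}$ (matroids not in $\mathcal{M}$ all of whose proper minors are in $\mathcal{M}$). Define $\Gamma_{\mathcal{M}}(n)=x_{n}/(m_{n}+x_{n})$. The class $\mathcal{M}$ is strongly fractal if $\lim_{n\to\infty}\Gamma_{\mathcal{M}}(n)=1$. *)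

(* Defs.v *)
From HB Require Import structures.
From mathcomp Require Import all_boot all_fingroup all_order all_algebra.

Set Implicit Arguments.
Unset Strict Implicit.
Unset Printing Implicit Defensive.

Import Order.TTheory GRing.Theory Num.Theory.

(* The pair of a ground set and a family of independent sets. The ground set
   is an arbitrary subset of the carrier type, so that the minors of a matroid
   are matroids over the same carrier. *)
Definition is_matroid (T : finType) (p : {set T} * {set {set T}}) : bool :=
  [&& set0 \in p.2,
      [forall A in p.2, A \subset p.1],
      [forall A in p.2, forall B : {set T}, (B \subset A) ==> (B \in p.2)]
    & [forall A in p.2, forall B in p.2, (#|A| < #|B|) ==>
        [exists e in B :\: A, (e |: A) \in p.2]]].

Record matroid (T : finType) := Matroid {
  mpair : {set T} * {set {set T}};
  mpairP : is_matroid mpair }.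

HB.instance Definition _ (T : finType) := [isSub for @mpair T].
HB.instance Definition _ (T : finType) := [Finite of matroid T by <:].

Definition ground (T : finType) (M : matroid T) : {set T} := (mpair M).1.
Definition indep (T : finType) (M : matroid T) : {set {set T}} := (mpair M).2.

Definition rank (T : finType) (M : matroid T) (X : {set T}) : nat :=
  \max_(A in indep M | A \subset X) #|A|.

Definition spanning (T : finType) (M : matroid T) (X : {set T}) : bool :=
  (X \subset ground M) && (rank M X == rank M (ground M)).

Definition circuit (T : finType) (M : matroid T) (X : {set T}) : bool :=
  minset [pred Y : {set T} | (Y \subset ground M) && (Y \notin indep M)] X.

Definition mclosure (T : finType) (M : matroid T) (X : {set T}) : {set T} :=
  [set e in ground M | rank M (e |: X) == rank M X].

Definition flat (T : finType) (M : matroid T) (X : {set T}) : bool :=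
  (X \subset ground M) && (mclosure M X == X).

(* A matroid of rank 0 has no hyperplane. *)
Definition hyperplane (T : finType) (M : matroid T) (X : {set T}) : bool :=
  flat M X && ((rank M X).+1 == rank M (ground M)).

Definition sparse_paving (T : finType) (M : matroid T) : bool :=
  [forall X : {set T}, (circuit M X && ~~ spanning M X) ==> hyperplane M X].

Definition circuit_hyperplanes (T : finType) (M : matroid T) : {set {set T}} :=
  [set X : {set T} | circuit M X && hyperplane M X].

Definition delete_pair (T : finType) (M : matroid T) (D : {set T}) :
    {set T} * {set {set T}} :=
  (ground M :\: D, [set A in indep M | A \subset ground M :\: D]).

Definition contract_pair (T : finType) (M : matroid T) (C : {set T}) :
    {set T} * {set {set T}} :=
  (ground M :\: C,
   [set A : {set T} | (A \subset ground M :\: C) &&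
                      (rank M (A :|: C) == #|A| + rank M C)]).

Lemma matroidP (T : finType) (p : {set T} * {set {set T}}) :
  reflect [/\ set0 \in p.2,
              forall A, A \in p.2 -> A \subset p.1,
              forall A B : {set T}, A \in p.2 -> B \subset A -> B \in p.2
            & forall A B : {set T}, A \in p.2 -> B \in p.2 -> #|A| < #|B| ->
                exists2 e, e \in B :\: A & (e |: A) \in p.2]
          (is_matroid p).
Proof.
apply: (iffP and4P) => -[h0 h1 h2 h3]; split => //.
- by move=> A pA; move/forall_inP: h1; apply.
- move=> A B pA sBA; move/forall_inP: h2 => /(_ A pA) /forallP /(_ B).
  by move/implyP; apply.
- move=> A B pA pB ltAB.
  move/forall_inP: h3 => /(_ A pA) /forall_inP /(_ B pB) /implyP /(_ ltAB).
  by case/exists_inP => e ? ?; exists e.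
- exact/forall_inP.
- apply/forall_inP => A pA; apply/forallP => B; apply/implyP => sBA.
  exact: h2 sBA.
- apply/forall_inP => A pA; apply/forall_inP => B pB; apply/implyP => ltAB.
  by apply/exists_inP; have [e ? ?] := h3 A B pA pB ltAB; exists e.
Qed.

Lemma leq_rank (T : finType) (M : matroid T) (A X : {set T}) :
  A \in indep M -> A \subset X -> #|A| <= rank M X.
Proof.
move=> iA sAX.
exact: (@leq_bigmax_cond _ [pred B | (B \in indep M) && (B \subset X)]
          (fun B : {set T} => #|B|) A (introT andP (conj iA sAX))).
Qed.

Lemma rank_basis (T : finType) (M : matroid T) (X : {set T}) :
  exists A, [/\ A \in indep M, A \subset X & #|A| = rank M X].
Proof.
have [h0 _ _ _] := matroidP _ (mpairP M).
pose P := [pred B : {set T} | (B \in indep M) && (B \subset X)].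
have P0 : 0 < #|P| by apply/card_gt0P; exists set0; rewrite inE sub0set andbT.
have [A /andP[iA sAX] eA] := eq_bigmax_cond (fun B : {set T} => #|B|) P0.
by exists A; split => //; rewrite -eA; apply: eq_bigl.
Qed.

Lemma extend_indep (T : finType) (M : matroid T) (A X : {set T}) :
  A \in indep M -> A \subset X ->
  exists B, [/\ B \in indep M, A \subset B, B \subset X & #|B| = rank M X].
Proof.
have [_ _ _ haug] := matroidP _ (mpairP M).
move=> iA sAX; have [n le_n] := ubnP (rank M X - #|A|).
elim: n A iA sAX le_n => // n IHn A iA sAX.
have [ltA|leA] := ltnP #|A| (rank M X); last first.
  move=> _; exists A; split => //; apply/eqP.
  by rewrite eqn_leq leA leq_rank.
have [B [iB sBX eB]] := rank_basis M X.
have [|e] := haug A B iA iB; first by rewrite eB.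
rewrite inE => /andP[eA eB'] ieA le_n.
have [|| C [iC sAC sCX eC]] := IHn (e |: A) ieA.
- by rewrite subUset sub1set sAX (subsetP sBX).
- by rewrite cardsU1 eA add1n subnS prednK // subn_gt0.
exists C; split => //; exact: subset_trans (subsetUr _ _) sAC.
Qed.

Lemma rankU_le (T : finType) (M : matroid T) (A C : {set T}) :
  rank M (A :|: C) <= #|A| + rank M C.
Proof.
have [_ _ hsub _] := matroidP _ (mpairP M).
have [B [iB sB <-]] := rank_basis M (A :|: C).
rewrite -(cardsID C B) addnC leq_add //.
  apply: subset_leq_card; apply/subsetP => x; rewrite inE => /andP[xC xB].
  by move: (subsetP sB x xB); rewrite inE (negbTE xC) orbF.
apply: leq_rank (subsetIr _ _); exact: hsub iB (subsetIl _ _).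
Qed.

Lemma contract_indep (T : finType) (M : matroid T) (C Z A : {set T}) :
  Z \in indep M -> Z \subset C -> #|Z| = rank M C -> [disjoint A & C] ->
  (rank M (A :|: C) == #|A| + rank M C) = (A :|: Z \in indep M).
Proof.
have [_ _ hsub _] := matroidP _ (mpairP M).
move=> iZ sZC cZ dAC.
have dAZ : A :&: Z = set0.
  by apply/eqP; rewrite setI_eq0; apply: disjointWr dAC.
have cAZ : #|A :|: Z| = #|A| + rank M C by rewrite cardsU dAZ cards0 subn0 cZ.
apply/eqP/idP => [eqr | iAZ]; last first.
  apply/eqP; rewrite eqn_leq rankU_le -cAZ; apply: leq_rank => //.
  exact: setUS.
have [|B [iB sZB sB cB]] := @extend_indep _ M Z (A :|: C) iZ.
- exact: subset_trans sZC (subsetUr _ _).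
have eBC : Z = B :&: C.
  apply/eqP; rewrite eqEcard subsetI sZB sZC cZ /=.
  by apply: leq_rank (subsetIr _ _); apply: hsub iB (subsetIl _ _).
suff -> : A :|: Z = B by [].
apply/eqP; rewrite eq_sym eqEcard cB eqr cAZ leqnn andbT.
apply/subsetP => x xB; move: (subsetP sB x xB).
by rewrite eBC !inE xB.
Qed.

Lemma delete_matroid (T : finType) (M : matroid T) (D : {set T}) :
  is_matroid (delete_pair M D).
Proof.
have [h0 _ hsub haug] := matroidP _ (mpairP M).
apply/matroidP; split => /=.
- by rewrite inE h0 sub0set.
- by move=> A; rewrite inE => /andP[].
- move=> A B; rewrite !inE => /andP[iA sA] sBA.
  by rewrite (hsub A) // (subset_trans sBA).
- move=> A B; rewrite !inE => /andP[iA sA] /andP[iB sB] ltAB.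
  have [e eBA ieA] := haug A B iA iB ltAB; exists e => //.
  rewrite inE ieA subUset sub1set sA andbT (subsetP sB) //.
  by move: eBA; rewrite inE => /andP[].
Qed.

Lemma contract_matroid (T : finType) (M : matroid T) (C : {set T}) :
  is_matroid (contract_pair M C).
Proof.
have [h0 _ hsub haug] := matroidP _ (mpairP M).
have [Z [iZ sZC cZ]] := rank_basis M C.
have dj (A : {set T}) : A \subset ground M :\: C -> [disjoint A & C].
  by rewrite subsetD => /andP[].
have memE (A : {set T}) : (A \in (contract_pair M C).2) =
    (A \subset ground M :\: C) && (A :|: Z \in indep M).
  rewrite inE; case sA : (A \subset _) => //=.
  by rewrite (contract_indep iZ sZC cZ) // dj.
apply/matroidP; split.
- by rewrite memE sub0set set0U.
- by move=> A; rewrite memE => /andP[].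
- move=> A B; rewrite !memE => /andP[sA iA] sBA.
  by rewrite (subset_trans sBA) //= (hsub _ _ iA) // setSU.
- move=> A B; rewrite !memE => /andP[sA iA] /andP[sB iB] ltAB.
  have cU (X : {set T}) : X \subset ground M :\: C -> #|X :|: Z| = #|X| + #|Z|.
    move=> /dj dX; rewrite cardsU.
    suff -> : X :&: Z = set0 by rewrite cards0 subn0.
    by apply/eqP; rewrite setI_eq0; apply: disjointWr dX.
  have [|e] := haug _ _ iA iB; first by rewrite !cU // ltn_add2r.
  rewrite !inE negb_or => /andP[/andP[eA eZ]]; rewrite (negbTE eZ) orbF => eB.
  rewrite setUA => ieA; exists e; first by rewrite inE eA eB.
  by rewrite memE ieA subUset sub1set sA (subsetP sB e eB).
Qed.

Definition delete (T : finType) (M : matroid T) (D : {set T}) : matroid T :=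
  Matroid (delete_matroid M D).

Definition contract (T : finType) (M : matroid T) (C : {set T}) : matroid T :=
  Matroid (contract_matroid M C).

Definition miso (T : finType) (M N : matroid T) : bool :=
  [exists s : {perm T},
     (ground N == s @: ground M) &&
     (indep N == [set s @: A | A : {set T} in indep M])].

Lemma miso_equiv (T : finType) (S : {set matroid T}) :
  {in S & &, equivalence_rel (@miso T)}.
Proof.
have refl (M : matroid T) : miso M M.
  have id1 (A : {set T}) : (1%g : {perm T}) @: A = A.
    by rewrite -[RHS]imset_id; apply: eq_imset => x; rewrite perm1.
  apply/existsP; exists 1%g; rewrite id1 eqxx.
  by rewrite (eq_imset _ id1) imset_id eqxx.
have sym (M N : matroid T) : miso M N -> miso N M.
  case/existsP => s /andP[/eqP eG /eqP eI].
  have sK (A : {set T}) :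
      (s^-1)%g @: (s @: A) = A.
    by rewrite -imset_comp -[RHS]imset_id; apply: eq_imset => x /=; rewrite permK.
  apply/existsP; exists s^-1%g; rewrite eG eI sK eqxx.
  by rewrite -imset_comp (eq_imset _ sK) imset_id eqxx.
have trans (M N P : matroid T) : miso M N -> miso N P -> miso M P.
  case/existsP => s /andP[/eqP eG /eqP eI].
  case/existsP => t /andP[/eqP eG' /eqP eI'].
  have st (A : {set T}) :
      t @: (s @: A) = (s * t)%g @: A.
    by rewrite -imset_comp; apply: eq_imset => x /=; rewrite permM.
  apply/existsP; exists (s * t)%g; rewrite eG' eG st eqxx.
  by rewrite eI' eI -imset_comp (eq_imset _ st) eqxx.
move=> M N P _ _ _; split => // isoMN.
by apply/idP/idP; apply: trans => //; apply: sym.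
Qed.

(* No invariance under isomorphism is imposed here; the classes considered
   below are invariant. *)
Definition matroid_class := forall T : finType, pred (matroid T).

Definition excluded_minor (P : matroid_class) : matroid_class :=
  fun T M => ~~ P T M &&
    [forall C : {set T}, forall D : {set T},
       [&& C \subset ground M, D \subset ground M, [disjoint C & D]
         & C :|: D != set0] ==> P T (delete (contract M C) D)].

(* The number of isomorphism classes of n-element matroids in P, each
   represented on the ground set 'I_n. *)
Definition num_iso (P : matroid_class) (n : nat) : nat :=
  #|equivalence_partition (@miso 'I_n)
      [set M : matroid 'I_n | (ground M == [set: 'I_n]) && P 'I_n M]|.

(* Imported only here because the set notations of classical_sets shadow those
   of finset. *)
From mathcomp Require Import classical_sets reals topology normedtype sequences.
Import numFieldNormedType.Exports.

Local Open Scope classical_set_scope.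
Local Open Scope ring_scope.

Definition Gamma (R : realType) (P : matroid_class) (n : nat) : R :=
  (num_iso (excluded_minor P) n)%:R /
  (num_iso P n + num_iso (excluded_minor P) n)%:R.

Definition strongly_fractal (R : realType) (P : matroid_class) : Prop :=
  Gamma R P n @[n --> \oo] --> (1 : R).

Definition sparse_paving_class (k : nat) : matroid_class :=
  fun T M => sparse_paving M && (#|circuit_hyperplanes M| <= k)%N.

(* Main.v *)
Require Import Defs.
From mathcomp Require Import all_boot all_order all_algebra.
From mathcomp Require Import all_fingroup zify.
From mathcomp Require Import reals topology normedtype sequences.

Set Implicit Arguments.
Unset Strict Implicit.
Unset Printing Implicit Defensive.

(** A sparse paving matroid is determined by its rank and its circuit-hyperplanes,
    and a family of [j] sets is determined up to isomorphism by the [2 ^ j] sizes of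
    its Venn regions; hence there are at most [(n + 1) ^ (2 ^ k + 1)] members of the
    class on [n] elements. A family of [k + 1] equicardinal sets, pairwise at distance
    at least 4, covering the ground set and with empty intersection, is the family of
    circuit-hyperplanes of an excluded minor. Each of the [2 ^ (k + 1) - k - 3] regions
    that lie in at least two but not all of the sets may be given any size up to about
    [n] over a constant, the remaining regions (those lying in a single set) being used
    to equalize the cardinalities. Up to the [(k + 1)!] relabellings of the sets these
    excluded minors are pairwise non-isomorphic, so their number has the larger growth
    exponent as soon as [k >= 3]. *)

(** * Sparse paving matroids built from separated families of sets *)

Definition separated (T : finType) (F : {set {set T}}) (r : nat) : Prop :=
  (forall X, X \in F -> #|X| = r) /\
  (forall X Y, X \in F -> Y \in F -> X != Y -> 1 < #|X :\: Y|).

(** The uniform matroid of rank [r] on [E], with the members of [F] made dependent. The actual rank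
    may fall below [r], so that minors keep this form. *)
Definition sp_indep (T : finType) (E : {set T}) (r : nat) (F : {set {set T}}) :
    {set {set T}} :=
  [set A : {set T} | [&& A \subset E, #|A| <= r & A \notin F]].

Lemma in_sp_indep (T : finType) (E A : {set T}) (r : nat) (F : {set {set T}}) :
  (A \in sp_indep E r F) = [&& A \subset E, #|A| <= r & A \notin F].
Proof. by rewrite inE. Qed.

Section SparsePaving.
Variables (T : finType).
Implicit Types (M : matroid T) (A B C D E X Y Z : {set T}) (F : {set {set T}}).

(** For sets of equal size, [1 < #|X :\: Y|] means symmetric difference at least 4, whereas
    exchanging one element changes only two. *)
Lemma separated_swap F r X x e :
  separated F r -> X \in F -> x \in X -> e \notin X -> e |: (X :\ x) \notin F.
Proof.
move=> [_ sep] XF xX eX; apply/negP => YF.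
have xY : x \notin e |: X :\ x.
  by rewrite !inE eqxx orbF; apply: contraNneq eX => <-.
have neq : X != e |: X :\ x by apply: contraNneq xY => <-.
have := sep _ _ XF YF neq; rewrite ltnNge => /negP; apply.
rewrite -(cards1 x); apply: subset_leq_card; apply/subsetP => y.
by rewrite !inE; case: (y \in X); rewrite ?andbT ?andbF //= negb_or negbK => /andP[].
Qed.

(** Augmenting [A] by [e] fails only if [e |: A] is in [F]. As [B] is not in [F], it is not
    [e |: A], so a second candidate [f] exists; [f |: A] is one exchange away from [e |: A], hence
    outside [F]. Positivity of [r] keeps the empty set out of [F]. *)
Lemma sp_matroid E F r : 0 < r -> separated F r -> is_matroid (E, sp_indep E r F).
Proof.
move=> r_gt0 sepF; have [cardF _] := sepF; apply/matroidP; split => /=.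
- rewrite inE sub0set cards0 /=; apply/negP => /cardF.
  by rewrite cards0 => r0; rewrite -r0 in r_gt0.
- by move=> A; rewrite inE => /and3P[].
- move=> A B; rewrite !inE => /and3P[sA cA AF] sBA.
  rewrite (subset_trans sBA) //= (leq_trans (subset_leq_card sBA)) //=.
  apply/negP => BF; case/negP: AF.
  suff <- : B = A by [].
  by apply/eqP; rewrite eqEcard sBA (cardF B).
move=> A B; rewrite !inE => /and3P[sA cA AF] /and3P[sB cB BF] ltAB.
have [e eBA] : exists e, e \in B :\: A.
  apply/set0Pn; rewrite setD_eq0; apply: contraTN ltAB => /subset_leq_card.
  by rewrite -leqNgt.
have ext f : f \in B :\: A -> (f |: A \in sp_indep E r F) = (f |: A \notin F).
  rewrite !inE => /andP[fA fB].
  by rewrite subUset sub1set sA (subsetP sB) // cardsU1 fA (leq_trans ltAB).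
have [eF|eF] := boolP (e |: A \in F); last by exists e; rewrite ?ext.
have [f fBA fe] : exists2 f, f \in B :\: A & f != e.
  have: ~~ (B :\: A \subset [set e]).
    apply: contra BF => sub; suff -> : B = e |: A by [].
    apply/eqP; rewrite eqEcard; apply/andP; split.
      by rewrite setUC -subDset.
    by move: eBA; rewrite cardsU1 inE => /andP[-> _].
  by case/subsetPn => f fBA; rewrite inE => fe; exists f.
exists f => //; rewrite ext //.
have eA : e \notin A by move: eBA; rewrite inE => /andP[].
have fA : f \notin A by move: fBA; rewrite inE => /andP[].
have := separated_swap sepF eF (setU11 e A) (_ : f \notin e |: A).
by rewrite setU1K //; apply; rewrite !inE negb_or fe.
Qed.

Section FixedMatroid.
Variables (M : matroid T) (r : nat) (F : {set {set T}}).
Hypotheses (sepF : separated F r) (defI : indep M = sp_indep (ground M) r F).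

Lemma sp_rank_le X : rank M X <= r.
Proof.
by have [A [+ _ <-]] := rank_basis M X; rewrite defI inE => /and3P[].
Qed.

Lemma circuit_proper X A : circuit M X -> A \proper X -> A \in indep M.
Proof.
move=> /minsetP[/andP[sX _] minX] AX; apply/negPn/negP => nA.
have := minX A; rewrite /= (subset_trans (proper_sub AX)) // nA.
by move=> /(_ isT (proper_sub AX)) eA; rewrite eA properxx in AX.
Qed.

(** A dependent set has more than [r] elements or lies in [F]; in the first case, a circuit minus a
    point is independent of size at least [r], so the circuit spans. *)
Lemma sp_nonspanning_circuit X : circuit M X -> ~~ spanning M X -> X \in F.
Proof.
move=> cX; have /minsetP[/andP[/= sX]] := cX.
rewrite defI inE sX /= negb_and negbK => /orP[rX|//] _.
rewrite -ltnNge in rX; rewrite /spanning sX /= => /negP[].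
have [x xX] : exists x, x \in X by apply/card_gt0P; apply: leq_ltn_trans rX.
have iX := circuit_proper cX (properD1 xX).
have := leq_rank iX (subD1set X x); have := cardsD1 x X; rewrite xX => eX leX.
have le1 := sp_rank_le X; have le2 := sp_rank_le (ground M).
have := leq_rank iX (subset_trans (subD1set X x) sX); lia.
Qed.

Lemma sp_swap_indep X x e : X \in F -> X \subset ground M -> x \in X ->
  e \in ground M -> e \notin X -> e |: X :\ x \in indep M.
Proof.
move=> XF sX xX eE eX; have [cardF _] := sepF.
rewrite defI inE (separated_swap sepF) // andbT subUset sub1set eE.
rewrite (subset_trans (subD1set _ _)) //= -(cardF X) //.
by rewrite cardsU1 (cardsD1 x X) xX !inE (negbTE eX) andbF.
Qed.

(** Such an [X] is in [F] and has rank [r - 1]. For [e] outside [X], swapping [e] for a point of [X]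
    gives an independent set of size [r], so [X] is closed. *)
Lemma sp_hyperplane X : circuit M X -> ~~ spanning M X -> hyperplane M X.
Proof.
move=> cX nX; have XF := sp_nonspanning_circuit cX nX.
have [/(_ X XF) cardX _] := sepF.
have /minsetP[/andP[/= sX dX] _] := cX.
have [x xX] : exists x, x \in X.
  apply/set0Pn; apply: contraNneq dX => ->.
  by have [] := matroidP _ (mpairP M).
have iX := circuit_proper cX (properD1 xX).
have eX := cardsD1 x X; rewrite xX cardX in eX.
have geX := leq_rank iX (subD1set X x).
have ltX : rank M X < r.
  rewrite ltn_neqAle sp_rank_le andbT; apply: contraNneq dX => eq_r.
  have [A [iA sAX cA]] := rank_basis M X.
  suff <- : A = X by [].
  by apply/eqP; rewrite eqEcard sAX cA cardX eq_r leqnn.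
have leE := sp_rank_le (ground M).
have geE : rank M X <= rank M (ground M).
  by have [A [iA sAX <-]] := rank_basis M X; apply: leq_rank (subset_trans sAX sX).
have neE : rank M X != rank M (ground M) by move: nX; rewrite /spanning sX.
have rkE : (rank M X).+1 = rank M (ground M) by lia.
rewrite /hyperplane rkE eqxx andbT /flat sX /=.
apply/eqP/setP => e; rewrite inE; have [eX'|eX'] := boolP (e \in X).
  rewrite (subsetP sX) //=; suff -> : e |: X = X by rewrite eqxx.
  by apply/setUidPr; rewrite sub1set.
apply/negbTE/andP => -[eE /eqP rk_e].
have := leq_rank (sp_swap_indep XF sX xX eE eX') (setUS _ (subD1set X x)).
by rewrite rk_e cardsU1 !inE (negbTE eX') andbF; lia.
Qed.

Lemma sp_sparse_paving : sparse_paving M.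
Proof.
by apply/forallP => X; apply/implyP => /andP[cX nX]; apply: sp_hyperplane.
Qed.

(** This inclusion applies to every minor, where [r] may exceed the rank and equality may fail. *)
Lemma sp_circuit_hyperplanes_sub : circuit_hyperplanes M \subset F.
Proof.
apply/subsetP => X; rewrite inE => /andP[cX /andP[_ /eqP rX]].
apply: sp_nonspanning_circuit cX _; rewrite /spanning -rX negb_and.
by rewrite neq_ltn ltnSn !orbT.
Qed.

Lemma sp_circuit_hyperplanes :
  (forall X, X \in F -> X \subset ground M) -> rank M (ground M) = r ->
  circuit_hyperplanes M = F.
Proof.
move=> sF rE; apply/eqP; rewrite eqEsubset sp_circuit_hyperplanes_sub /=.
apply/subsetP => X XF; have [/(_ X XF) cardX _] := sepF.
have dX : X \notin indep M by rewrite defI inE XF !andbF.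
have cX : circuit M X.
  apply/minsetP; split => /= [|A /andP[sA dA] sAX]; first by rewrite sF.
  apply/eqP; rewrite eqEcard sAX leqNgt; apply: contra dA => ltA.
  rewrite defI inE sA /= -cardX ltnW //=; apply/negP => AF.
  by have [/(_ A AF) cardA _] := sepF; rewrite cardA cardX ltnn in ltA.
rewrite inE cX sp_hyperplane // /spanning negb_and rE; apply/orP; right.
apply: contraNneq dX => eq_r.
have [A [iA sAX cA]] := rank_basis M X.
suff <- : A = X by [].
by apply/eqP; rewrite eqEcard sAX cA cardX eq_r leqnn.
Qed.

(* Contracting [C] amounts to adding a basis [Z] of [C], also when [C] is dependent. *)
Lemma sp_minor C D Z : C \subset ground M ->
  Z \in indep M -> Z \subset C -> #|Z| = rank M C ->
  let G := [set X in F | (Z \subset X) && (X :\: Z \subset (ground M :\: C) :\: D)] in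
  let F' := [set X :\: Z | X in G] in
  let N := delete (contract M C) D in
  separated F' (r - #|Z|) /\ indep N = sp_indep (ground N) (r - #|Z|) F'.
Proof.
move=> sC iZ sZC cZ G F' N; have [cardF sep] := sepF; split.
  split=> [X' /imsetP[X]|X' Y' /imsetP[X + ->] /imsetP[Y + ->]].
    rewrite inE => /and3P[XF ZX _] ->.
    by rewrite cardsD (setIidPr ZX) cardF.
  rewrite !inE => /and3P[XF ZX _] /and3P[YF ZY _] neq.
  have XY : X != Y by apply: contraNneq neq => ->.
  apply: leq_trans (sep X Y XF YF XY) (subset_leq_card _).
  apply/subsetP => x; rewrite !inE => /andP[xY xX].
  by rewrite xX (negbTE xY) !andbF andbT /=; apply: contra xY => /(subsetP ZY).
apply/setP => A; rewrite /N /indep /= !inE.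
change (ground (delete _ _)) with (ground M :\: C :\: D).
change (ground (contract _ _)) with (ground M :\: C).
case sA : (A \subset _ :\: D); last by rewrite andbF.
rewrite andbT /=.
have sAC : A \subset ground M :\: C by apply: subset_trans sA (subsetDl _ D).
have dAC : [disjoint A & C] by move: sAC; rewrite subsetD => /andP[].
rewrite sAC /= (contract_indep iZ) //.
have dAZ : A :&: Z = set0 by apply/eqP; rewrite setI_eq0; apply: disjointWr dAC.
have cAZ : #|A :|: Z| = #|A| + #|Z| by rewrite cardsU dAZ cards0 subn0.
have iZ' := iZ; rewrite defI inE in iZ'; case/and3P: iZ' => _ rZ _.
rewrite defI inE cAZ subUset (subset_trans sZC sC) andbT.
rewrite (subset_trans sAC (subsetDl _ _)) /= [#|A| <= _]leq_subRL 1?addnC //.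
(* Adding [Z] and removing [Z] are inverse to each other between sets disjoint from [Z] and sets
   containing [Z]. *)
congr (_ && ~~ _); apply/idP/imsetP => [AF | [X]].
  have eA : A = (A :|: Z) :\: Z.
    by rewrite setDUl setDv setU0; apply/esym/setDidPl; rewrite -setI_eq0 dAZ.
  by exists (A :|: Z) => //; rewrite inE AF subsetUr -eA sA.
rewrite inE => /and3P[XF ZX _] ->.
suff -> : X :\: Z :|: Z = X by [].
by rewrite setUC -{1}(setIidPr ZX) setID.
Qed.

Lemma sp_rank X : 0 < r -> X \in F -> X \proper ground M -> rank M (ground M) = r.
Proof.
move=> r_gt0 XF /properP[sX [e eE eX]]; have [/(_ X XF) cardX _] := sepF.
have [x xX] : exists x, x \in X by apply/card_gt0P; rewrite cardX.
have iX := sp_swap_indep XF sX xX eE eX.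
have sE : e |: X :\ x \subset ground M.
  by rewrite subUset sub1set eE (subset_trans (subD1set X x)).
apply/eqP; rewrite eqn_leq sp_rank_le /=.
apply: leq_trans (leq_rank iX sE).
by rewrite cardsU1 !inE (negbTE eX) andbF -cardX (cardsD1 x X) xX.
Qed.

End FixedMatroid.

(** All [k + 1] members of [F] are circuit-hyperplanes of [M], one too many. Every proper minor
    loses at least one: contracting [e] destroys a member avoiding [e], deleting [e] destroys a
    member containing [e]. *)
Lemma sp_excluded_minor M r F k :
  separated F r -> indep M = sp_indep (ground M) r F -> 0 < r -> #|F| = k.+1 ->
  (forall X, X \in F -> X \proper ground M) ->
  (forall e, e \in ground M -> exists2 X, X \in F & e \in X) ->
  (forall e, e \in ground M -> exists2 X, X \in F & e \notin X) ->
  excluded_minor (sparse_paving_class k) M.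
Proof.
move=> sepF defI r_gt0 cF sF covF capF; apply/andP; split.
  have [X XF] : exists X, X \in F by apply/card_gt0P; rewrite cF.
  rewrite /sparse_paving_class (sp_circuit_hyperplanes sepF defI) ?cF ?ltnn ?andbF //.
    by move=> Y /sF /proper_sub.
  exact: (sp_rank sepF defI r_gt0 XF (sF X XF)).
apply/forallP => C; apply/forallP => D; apply/implyP => /and4P[sC sD dCD nCD].
have [Z [iZ sZ cZ]] := rank_basis M C.
have [sep' defI'] := sp_minor sepF defI D sC iZ sZ cZ.
rewrite /sparse_paving_class (sp_sparse_paving sep' defI') /=.
apply: leq_trans (subset_leq_card (sp_circuit_hyperplanes_sub defI')) _.
apply: leq_trans (leq_imset_card _ _) _; rewrite -ltnS -cF; apply: proper_card.
apply/properP; split; first by apply/subsetP => X; rewrite inE => /andP[].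
case/set0Pn: nCD => e eCD.
have eE : e \in ground M.
  by move: eCD; rewrite inE => /orP[/(subsetP sC)|/(subsetP sD)].
(* Outside the basis [Z], an element of [C] becomes a loop once [Z] is contracted, so it behaves
   like a deleted element. *)
have [eZ|eZ] := boolP (e \in Z).
  have [X XF eX] := capF e eE; exists X => //; rewrite inE XF /=.
  by apply/nandP; left; apply: contra eX => /subsetP; apply.
have [X XF eX] := covF e eE; exists X => //; rewrite inE XF /=.
apply/nandP; right; apply/subsetPn; exists e; first by rewrite inE eZ.
by move: eCD; rewrite !inE eE andbT => /orP[] ->; rewrite ?andbF.
Qed.

(** A dependent [A] of size at most the rank contains a circuit, which has rank less than [#|A|] and
    so is not spanning. It is then a hyperplane, hence has at least as many elements as the rank of
    [M], and equals [A]. *)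
Lemma sparse_paving_indep M : sparse_paving M ->
  indep M = sp_indep (ground M) (rank M (ground M)) (circuit_hyperplanes M).
Proof.
move=> spM; have [_ hE hsub _] := matroidP _ (mpairP M).
apply/setP => A; rewrite inE; apply/idP/and3P => [iA | [sA cA hA]].
  split; [exact: hE | exact: leq_rank iA (hE _ iA) |].
  by rewrite inE; apply/negP => /andP[/minsetP[/= /andP[_ /negP]]].
apply/negPn/negP => dA.
have [X cX sXA] := @minset_exists _
  [pred Y : {set T} | (Y \subset ground M) && (Y \notin indep M)] A
  (introT andP (conj sA dA)).
have /minsetP[/= /andP[sX dX] _] := cX.
have rX : rank M X < #|X|.
  have [B [iB sB <-]] := rank_basis M X; rewrite ltn_neqAle subset_leq_card // andbT.
  apply: contraNneq dX => eB; suff <- : B = X by [].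
  by apply/eqP; rewrite eqEcard sB eB leqnn.
have leXA := subset_leq_card sXA.
have nX : ~~ spanning M X by rewrite /spanning sX /=; lia.
have hX : hyperplane M X.
  by have := forallP spM X; rewrite [circuit M X]cX nX; apply.
case/negP: hA; suff <- : X = A by rewrite inE [circuit M X]cX.
by case/andP: hX => _ /eqP eX; apply/eqP; rewrite eqEcard sXA; lia.
Qed.

Lemma sparse_paving_miso M N (s : {perm T}) : sparse_paving M -> sparse_paving N ->
  ground N = s @: ground M -> rank M (ground M) = rank N (ground N) ->
  circuit_hyperplanes N = [set s @: X | X : {set T} in circuit_hyperplanes M] ->
  miso M N.
Proof.
move=> spM spN gE rE hE; apply/existsP; exists s; rewrite gE eqxx /=.
have inj_s : injective (fun A : {set T} => s @: A) by apply/imset_inj/perm_inj.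
have sK (A : {set T}) : A = s @: (s^-1%g @: A).
  rewrite -imset_comp -[LHS]imset_id; apply: eq_imset => x /=; by rewrite permKV.
apply/eqP/setP => A; rewrite (sK A) (mem_imset _ _ inj_s).
rewrite (sparse_paving_indep spM) (sparse_paving_indep spN) !in_sp_indep -rE gE hE.
rewrite (mem_imset _ _ inj_s) (card_imset _ (@perm_inj _ s)); congr (_ && _).
apply/idP/idP => [|/imsetS -> //]; set B := _ @: A.
move=> /subsetP sub; apply/subsetP => x xB.
by have := sub _ (imset_f s xB); rewrite (mem_imset _ _ (@perm_inj _ s)).
Qed.

End SparsePaving.

(** * Counting tools: fiber sizes and equivalence classes *)

Lemma perm_of_fibers (U : finType) n (f g : 'I_n -> U) :
  (forall u, #|[set x | f x == u]| = #|[set x | g x == u]|) ->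
  exists s : {perm 'I_n}, forall x, f x = g (s x).
Proof.
move=> eq_fib.
have cnt (h : 'I_n -> U) u : count_mem u [tuple h i | i < n] = #|[set x | h x == u]|.
  rewrite /= count_map cardE enumT [enum (mem [set _ | _])]/enum_mem size_filter.
  by apply: eq_count => x /=; rewrite inE.
(* Equal fiber sizes mean that the two tuples of values agree as multisets. *)
have /tuple_permP[s es] : perm_eq [tuple f i | i < n] [tuple g i | i < n].
  by apply/allP => u _; apply/eqP; rewrite !cnt.
exists s => x.
have /(congr1 (fun t => tnth t x)) := val_inj es.
by rewrite !tnth_mktuple.
Qed.

Section EquivalenceCounting.
Variables (T I : finType) (e : rel T) (D : {set T}).
Hypothesis eqv : {in D & &, equivalence_rel e}.

(** [h] is injective on a transversal of the classes. It may take different values on equivalent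
    elements, which permits data depending on an enumeration. *)
Lemma card_classes_le (h : T -> I) :
  {in D &, forall x y, h x = h y -> e x y} -> #|equivalence_partition e D| <= #|I|.
Proof.
move=> hP; have pP := equivalence_partitionP eqv.
have tX := transversalP pP; rewrite -(card_transversal tX).
have sX := transversal_sub tX.
rewrite -(@card_in_imset _ _ h) ?max_card // => x y xX yX /hP exy.
have xD := subsetP sX x xX; have yD := subsetP sX y yX.
apply: (pblock_inj tX) => //; apply/eqP; rewrite eq_pblock.
- by rewrite pblock_equivalence_partition // exy.
- by have /and3P[] := pP.
- by rewrite (cover_partition pP).
Qed.

(** Indices are grouped by the class of [h i]; a nonempty group consists of indices equivalent to
    any one of its members, so it has size at most [c]. *)
Lemma card_classes_ge (h : I -> T) c : (forall i, h i \in D) ->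
  (forall i, #|[set j | e (h i) (h j)]| <= c) -> #|I| <= c * #|equivalence_partition e D|.
Proof.
move=> hD hc; have pP := equivalence_partitionP eqv.
set P := equivalence_partition e D in pP *.
have hP i : pblock P (h i) \in P by rewrite pblock_mem // (cover_partition pP).
rewrite -[#|I|]sum1_card (partition_big (fun i => pblock P (h i)) (fun B => B \in P)) //=.
rewrite mulnC -sum_nat_const; apply: leq_sum => B BP.
have [i /eqP hi|none] := pickP (fun i => pblock P (h i) == B); last first.
  by rewrite big_pred0 // => i; rewrite none.
rewrite sum1_card; apply: leq_trans (hc i); apply: subset_leq_card.
apply/subsetP => j jB; have hj : pblock P (h j) = B by exact/eqP.
rewrite inE.
rewrite -(pblock_equivalence_partition eqv) // -/P hi -hj mem_pblock.
by rewrite (cover_partition pP).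
Qed.

End EquivalenceCounting.

Lemma exists_fibers (U : finType) n (a : U -> nat) : \sum_u a u = n ->
  exists f : 'I_n -> U, forall u, #|[set x | f x == u]| = a u.
Proof.
(* A word of length [n] with [a u] copies of each letter [u]; [f] reads it by position. *)
move=> sum_a; pose w := flatten [seq nseq (a u) u | u : U].
have sz : size w == n.
  rewrite size_flatten /shape -map_comp sumnE big_map -sum_a big_enum /=.
  by apply/eqP; apply: eq_bigr => u _; rewrite /= size_nseq.
exists (tnth (Tuple sz)) => u.
have -> : a u = count_mem u w.
  rewrite count_flatten -map_comp sumnE big_map big_enum /= (bigD1 u) //=.
  rewrite count_nseq /= eqxx mul1n big1 ?addn0 // => v vu.
  by rewrite count_nseq /= (negbTE vu).
have {2}-> : w = [tuple tnth (Tuple sz) i | i < n].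
  rewrite -[LHS]/(tval (Tuple sz)); congr tval.
  by apply/eq_from_tnth => i; rewrite tnth_mktuple.
rewrite /= count_map cardE enumT [enum (mem [set _ | _])]/enum_mem size_filter.
by apply: eq_count => x /=; rewrite inE.
Qed.

Lemma card_set_ord K : #|{set 'I_K}| = 2 ^ K.
Proof. by rewrite -cardsT -powersetT card_powerset cardsT card_ord. Qed.

(** * Upper bound for the number of members of the class *)

Section UpperBound.
Variables (k n : nat).
Implicit Types M N : matroid 'I_n.

(* The padding by [set0] is recognizable, since a circuit is never empty. *)
Definition ch_nth M (i : 'I_k) : {set 'I_n} := nth set0 (enum (circuit_hyperplanes M)) i.

(** The fibers are the Venn regions of the circuit-hyperplanes, labelled according to the chosen
    enumeration. *)
Definition ch_type M (x : 'I_n) : {set 'I_k} := [set i | x \in ch_nth M i].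

Lemma circuit_neq0 M X : circuit M X -> X != set0.
Proof.
case/minsetP => /= /andP[_ dX] _; apply: contraNneq dX => ->.
by have [] := matroidP _ (mpairP M).
Qed.

Lemma ch_nthP M X : #|circuit_hyperplanes M| <= k ->
  reflect (X != set0 /\ exists i, X = ch_nth M i) (X \in circuit_hyperplanes M).
Proof.
move=> leM; apply: (iffP idP) => [XH | [X0 [i eX]]].
  split; first by move: XH; rewrite inE => /andP[/circuit_neq0].
  have XE : X \in enum (circuit_hyperplanes M) by rewrite mem_enum.
  have ltk : index X (enum (circuit_hyperplanes M)) < k.
    by apply: leq_trans leM; rewrite cardE index_mem.
  by exists (Ordinal ltk); rewrite /ch_nth nth_index.
rewrite -mem_enum eX mem_nth // ltnNge; apply: contra X0 => ge_i.
by rewrite eX /ch_nth nth_default.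
Qed.

(** Equal region sizes give a permutation of the ground set carrying the [i]-th circuit-hyperplane
    of [M] to that of [N]; with the rank, these determine the matroid. *)
Lemma ch_type_miso M N : ground M = setT -> ground N = setT ->
  sparse_paving_class k M -> sparse_paving_class k N ->
  rank M (ground M) = rank N (ground N) ->
  (forall S, #|[set x | ch_type M x == S]| = #|[set x | ch_type N x == S]|) ->
  miso M N.
Proof.
move=> gM gN /andP[spM cM] /andP[spN cN] eq_r /perm_of_fibers[s es].
have inj_s := @perm_inj _ s.
have imT : s @: [set: 'I_n] = [set: 'I_n].
  by apply/eqP; rewrite eqEcard subsetT card_imset ?leqnn.
have nthE i : ch_nth N i = s @: ch_nth M i.
  apply/setP => y; rewrite -(permKV s y) (mem_imset _ _ inj_s).
  by have /setP/(_ i) := es (s^-1%g y); rewrite !inE.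
apply: (sparse_paving_miso spM spN (s := s)) => //; first by rewrite gM gN imT.
have im0 (X : {set 'I_n}) : (s @: X == set0) = (X == set0) by rewrite imset_eq0.
apply/setP => Y; apply/(ch_nthP _ cN)/imsetP.
  move=> [Y0 [i eY]]; exists (ch_nth M i); last by rewrite eY nthE.
  by apply/(ch_nthP _ cM); split; [rewrite -im0 -nthE -eY | exists i].
move=> [X /(ch_nthP _ cM)[X0 [i eX]] ->]; rewrite im0; split => //.
by exists i; rewrite nthE eX.
Qed.

Lemma num_iso_sparse_paving_le :
  num_iso (sparse_paving_class k) n <= n.+1 ^ (2 ^ k).+1.
Proof.
(* The rank and the [2 ^ k] region sizes are all at most [n], so [inord] loses no information. *)
pose h M : 'I_n.+1 * {ffun {set 'I_k} -> 'I_n.+1} :=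
  (inord (rank M (ground M)), [ffun S => inord #|[set x | ch_type M x == S]|]).
have cardI : #|{: 'I_n.+1 * {ffun {set 'I_k} -> 'I_n.+1}}| = n.+1 ^ (2 ^ k).+1.
  by rewrite card_prod card_ffun !card_ord -expnS card_set_ord.
rewrite -cardI /num_iso; set D := [set M | _].
have := card_classes_le (@miso_equiv _ D) (h := h); apply; rewrite {}/D.
move=> M N; rewrite !inE => /andP[/eqP gM PM] /andP[/eqP gN PN] [eq_r /ffunP eq_f].
have cord (A : {set 'I_n}) : #|A| < n.+1 by rewrite ltnS -[n in _ <= n]card_ord max_card.
have rk (L : matroid 'I_n) : rank L (ground L) < n.+1.
  by have [A [_ _ <-]] := rank_basis L (ground L).
apply: ch_type_miso => //.
  by have := congr1 val eq_r; rewrite /= !inordK.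
by move=> S; have /(congr1 val) := eq_f S; rewrite !ffunE /= !inordK.
Qed.

End UpperBound.

(** * Excluded minors with prescribed Venn region sizes *)

Definition region (T : finType) K (f : T -> {set 'I_K}) (i : 'I_K) : {set T} :=
  [set x | i \in f x].

(** The Venn regions are the fibers of [f], with sizes [a], whereas [region f i] is the whole [i]-th
    set. The independent set of size [r] makes [r] recoverable from [M]. *)
Definition realizes n K (M : matroid 'I_n) (a : {set 'I_K} -> nat) : Prop :=
  exists (f : 'I_n -> {set 'I_K}) (r : nat),
    [/\ forall S, #|[set x | f x == S]| = a S,
        injective (region f),
        forall i, #|region f i| = r,
        indep M = sp_indep setT r [set region f i | i : 'I_K]
      & exists2 A, A \in indep M & #|A| = r].

Lemma card_region n K (f : 'I_n -> {set 'I_K}) i :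
  #|region f i| = \sum_(S : {set 'I_K} | i \in S) #|[set x | f x == S]|.
Proof.
rewrite -sum1_card (partition_big f (fun S => i \in S)) /=; last first.
  by move=> x; rewrite inE.
apply: eq_bigr => S iS; rewrite -sum1_card; apply: eq_bigl => x.
by rewrite !inE; case: eqP => [->|]; rewrite ?iS ?andbF.
Qed.

(** Two points lying in the [i]-th set alone separate it from every other set; [a set0 = 0] makes
    the sets cover the ground set, and [a setT = 0] makes their intersection empty. *)
Lemma exists_realization k n r (a : {set 'I_k.+1} -> nat) : 0 < k ->
  \sum_S a S = n -> (forall i, \sum_(S : {set 'I_k.+1} | i \in S) a S = r) ->
  (forall i, 1 < a [set i]) -> a set0 = 0 -> a setT = 0 ->
  exists M : matroid 'I_n, [/\ ground M = setT,
    excluded_minor (sparse_paving_class k) M & realizes M a].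
Proof.
move=> k_gt0 /exists_fibers[f fib] sum_r a1 a0 aT.
have card_f i : #|region f i| = r.
  by rewrite card_region -(sum_r i); apply: eq_bigr => S _; apply: fib.
have sepf i j : i != j -> 1 < #|region f i :\: region f j|.
  move=> ij; apply: leq_trans (a1 i) _; rewrite -fib; apply: subset_leq_card.
  apply/subsetP => x; rewrite !inE => /eqP ->.
  by rewrite !inE eqxx andbT eq_sym.
have inj_f : injective (region f).
  move=> i j eij; apply/eqP; apply: contraT => /sepf.
  by rewrite eij setDv cards0.
pose F := [set region f i | i : 'I_k.+1].
have sepF : separated F r.
  split=> [X /imsetP[i _ ->] //|X Y /imsetP[i _ ->] /imsetP[j _ ->] neq].
  by apply: sepf; apply: contraNneq neq => ->.
have f_gt0 x : exists i, i \in f x.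
  apply/set0Pn; apply: contraT => /negPn fx.
  have : 0 < #|[set y | f y == set0]| by apply/card_gt0P; exists x; rewrite inE.
  by rewrite fib a0.
have f_ltT x : exists i, i \notin f x.
  apply/existsP; rewrite -negb_forall; apply/negP => /forallP fx.
  have : 0 < #|[set y | f y == setT]|.
    by apply/card_gt0P; exists x; rewrite inE; apply/eqP/setP => i; rewrite fx inE.
  by rewrite fib aT.
have region_gt0 i : exists x, x \in region f i.
  have : 0 < #|[set y | f y == [set i]]| by rewrite fib ltnW.
  by case/card_gt0P => x; rewrite inE => /eqP fx; exists x; rewrite inE fx inE.
have r_gt0 : 0 < r by rewrite -(card_f ord0); apply/card_gt0P.
pose M := Matroid (sp_matroid [set: 'I_n] r_gt0 sepF).
have gM : ground M = setT by [].
have defM : indep M = sp_indep (ground M) r F by [].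
have properF X : X \in F -> X \proper ground M.
  case/imsetP => i _ ->; rewrite gM properT.
  have [j ji] : exists j : 'I_k.+1, j != i.
    have : 0 < #|[set~ i]| by rewrite cardsC1 card_ord.
    by case/card_gt0P => j; rewrite !inE; exists j.
  apply: contraTneq (sepf j i ji) => ->.
  by rewrite setDT cards0.
exists M; split=> //.
  apply: (sp_excluded_minor sepF defM r_gt0 _ properF) => [|x _|x _].
  - by rewrite card_imset // card_ord.
  - by have [i fx] := f_gt0 x; exists (region f i); rewrite ?imset_f // inE.
  - by have [i fx] := f_ltT x; exists (region f i); rewrite ?imset_f // inE.
exists f, r; split=> //.
have XF : region f ord0 \in F by apply: imset_f.
have [A [iA _ cA]] := rank_basis M (ground M); exists A => //.
by rewrite cA; apply: sp_rank XF (properF _ XF).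
Qed.

(** The sets of the family are exactly the dependent sets of size [r], so an isomorphism permutes
    them, and [s] is the induced permutation of indices. *)
Lemma realizes_miso n K (M N : matroid 'I_n) (a b : {set 'I_K} -> nat) :
  realizes M a -> realizes N b -> miso M N ->
  exists s : {perm 'I_K}, forall S, a S = b (s @: S).
Proof.
move=> [f [r [fa inj_f card_f defM [A iA cA]]]].
move=> [g [r' [gb inj_g card_g defN [B iB cB]]]].
case/existsP => t /andP[_ /eqP iN].
have inj_t := @perm_inj _ t.
have eq_r : r' = r.
  apply/eqP; rewrite eqn_leq; apply/andP; split.
    move: iB; rewrite iN => /imsetP[A' + eB]; rewrite -cB eB card_imset //.
    by rewrite defM inE => /and3P[].
  have : t @: A \in indep N by rewrite iN; apply: imset_f.
  by rewrite defN inE card_imset // cA => /and3P[].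
rewrite {r'}eq_r in card_g defN cB.
have im_t (X : {set 'I_n}) : (t @: X \in indep N) = (X \in indep M).
  by rewrite iN (mem_imset _ _ (imset_inj inj_t)).
have reg i : exists j, region g j = t @: region f i.
  have : t @: region f i \notin indep N.
    by rewrite im_t defM inE imset_f // !andbF.
  rewrite defN inE subsetT card_imset // card_f leqnn negbK.
  by case/imsetP => j _ ->; exists j.
have [s0 s0P] := fin_all_exists reg.
have inj_s : injective s0.
  by move=> i j eij; apply/inj_f/(imset_inj inj_t); rewrite -!s0P eij.
exists (perm inj_s) => S; rewrite -fa -gb -(card_imset _ inj_t).
congr #|pred_of_set _|; apply/setP => y; rewrite -(permKV t y).
set x := (t^-1%g) y; rewrite (mem_imset _ _ inj_t) !inE.
have gt : g (t x) = perm inj_s @: f x.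
  apply/setP => j; rewrite -(permKV (perm inj_s) j) (mem_imset _ _ (@perm_inj _ _)).
  set i := ((perm inj_s)^-1%g) j; rewrite permE.
  have : (t x \in region g (s0 i)) = (x \in region f i).
    by rewrite s0P (mem_imset _ _ inj_t).
  by rewrite !inE.
by rewrite gt (inj_eq (imset_inj (@perm_inj _ _))).
Qed.

(** * Equalizing the set sizes by means of the singleton regions *)

Section SingletonCompletion.
Variables (k n r : nat) (c : {set 'I_k.+1} -> nat).
Hypothesis k_gt0 : 0 < k.
Hypothesis c_mid : forall S : {set 'I_k.+1}, ~~ (1 < #|S| < k.+1) -> c S = 0.
Hypothesis r_eq : k.+1 * r = n + \sum_(S : {set 'I_k.+1}) #|S|.-1 * c S.
Hypothesis r_big : \sum_S c S + 2 <= r.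

(* The singleton regions are chosen so that every set has size [r]. *)
Definition completion (S : {set 'I_k.+1}) : nat :=
  if #|S| == 1 then r - \sum_(S' : {set 'I_k.+1} | S \subset S') c S' else c S.

Lemma completion1 i :
  completion [set i] + \sum_(S : {set 'I_k.+1} | i \in S) c S = r.
Proof.
rewrite /completion cards1 eqxx.
under eq_bigl => S do rewrite sub1set.
(* [r_big] makes the truncated subtraction exact; its summand 2 later gives two private points to
   each set. *)
rewrite subnK //; apply: leq_trans r_big; apply: leq_trans (leq_addr _ _).
by rewrite [X in _ <= X](bigID (fun S : {set 'I_k.+1} => i \in S)) /= leq_addr.
Qed.

Lemma completion1_gt1 i : 1 < completion [set i].
Proof.
have := completion1 i; have : \sum_(S : {set 'I_k.+1} | i \in S) c S <= \sum_S c S.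
  by rewrite [X in _ <= X](bigID (fun S : {set 'I_k.+1} => i \in S)) /= leq_addr.
by move: r_big; lia.
Qed.

Lemma completion_mid (S : {set 'I_k.+1}) : 1 < #|S| < k.+1 -> completion S = c S.
Proof. by rewrite /completion; case: eqP => // ->. Qed.

Lemma completion_sum i : \sum_(S : {set 'I_k.+1} | i \in S) completion S = r.
Proof.
rewrite -(completion1 i) (bigD1 [set i]) ?inE //=; congr (_ + _).
rewrite [RHS](bigD1 [set i]) ?inE //= c_mid ?cards1 // add0n.
apply: eq_bigr => S /andP[iS neq]; rewrite /completion; case: cards1P => // -[j eS].
by move: iS neq; rewrite eS inE => /eqP ->; rewrite eqxx.
Qed.

(** Double counting: the set sizes add up to [k.+1 * r], where a point of region [S] is counted
    [#|S|] times. The excess [#|S|.-1] over a single count vanishes on singletons, so [r_eq]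
    involves [c] alone. *)
Lemma completion_total : \sum_S completion S = n.
Proof.
rewrite (bigID (fun S : {set 'I_k.+1} => #|S| == 1)) /=.
have -> : \sum_(S : {set 'I_k.+1} | #|S| != 1) completion S = \sum_S c S.
  rewrite [RHS](bigID (fun S : {set 'I_k.+1} => #|S| == 1)) /= [X in _ = X + _]big1.
    by rewrite add0n; apply: eq_bigr => S /negbTE; rewrite /completion => ->.
  by move=> S /eqP S1; rewrite c_mid // S1.
have -> : \sum_(S : {set 'I_k.+1} | #|S| == 1) completion S = \sum_i completion [set i].
  have -> : \sum_i completion [set i] =
      \sum_(S in [set [set i] | i : 'I_k.+1]) completion S.
    by rewrite big_imset //= => i j _ _ /set1_inj.
  apply: eq_bigl => S; apply/cards1P/imsetP => [[i ->]|[i _ ->]]; first by exists i.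
  by exists i.
have : \sum_i completion [set i] + \sum_(S : {set 'I_k.+1}) #|S| * c S = k.+1 * r.
  have -> : k.+1 * r = \sum_(i < k.+1) r by rewrite sum_nat_const card_ord.
  rewrite -(eq_bigr _ (fun i _ => completion1 i)) big_split /=; congr (_ + _).
  rewrite (exchange_big_dep xpredT) //=; apply: eq_bigr => S _.
  by rewrite sum_nat_const.
have -> : \sum_(S : {set 'I_k.+1}) #|S| * c S =
    \sum_(S : {set 'I_k.+1}) #|S|.-1 * c S + \sum_S c S.
  rewrite -big_split /=; apply: eq_bigr => S _.
  have [mid|/c_mid ->] := boolP (1 < #|S| < k.+1); last by rewrite !muln0.
  by case: #|S| mid => // m _; rewrite mulSn addnC.
by rewrite r_eq; lia.
Qed.

Lemma exists_completion : exists M : matroid 'I_n, [/\ ground M = setT,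
    excluded_minor (sparse_paving_class k) M & realizes M completion].
Proof.
apply: (exists_realization k_gt0 completion_total completion_sum completion1_gt1).
  by rewrite /completion cards0 c_mid ?cards0.
rewrite /completion cardsT card_ord eqSS gtn_eqF // c_mid // cardsT card_ord.
by rewrite ltnn andbF.
Qed.

End SingletonCompletion.

(** * Lower bound for the number of excluded minors *)

Definition mid_set K := {S : {set 'I_K} | 1 < #|S| < K}.

(** The sets left out are the [K] singletons, the empty set and the full set, which may coincide for
    small [K]. *)
Lemma card_mid_set K : 2 ^ K - (K + 2) <= #|{: mid_set K}|.
Proof.
rewrite card_sig leq_subLR.
rewrite -card_set_ord -(cardC [pred S : {set 'I_K} | 1 < #|S| < K]) addnC leq_add2r.
have sub : [predC [pred S : {set 'I_K} | 1 < #|S| < K]] \subset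
    [set [set i] | i : 'I_K] :|: [set set0; setT].
  apply/subsetP => S; rewrite !inE.
  have [/cards1P[i ->]|S1] := boolP (#|S| == 1); first by rewrite imset_f.
  have [->|S0] := eqVneq S set0; first by rewrite orbT.
  rewrite negb_and -!leqNgt => /orP[S2|SK].
    by move: S0 S1; rewrite -cards_eq0; lia.
  suff -> : S = setT by rewrite eqxx !orbT.
  by apply/eqP; rewrite eqEcard subsetT cardsT card_ord.
apply: leq_trans (subset_leq_card sub) _.
apply: leq_trans (leq_card_setU _ _) _; apply: leq_add.
  by apply: leq_trans (leq_imset_card _ _) _; rewrite card_ord.
by rewrite cards2; case: eqP.
Qed.

Section LowerBound.
Variables (k n N : nat).
Hypothesis k_gt1 : 1 < k.
Hypothesis n_big : k.+1 * (2 ^ k.+1 * (k.+1 * N.+1) + 2) <= n.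

Let pair_set : {set 'I_k.+1} := [set ord0; ord_max].
Let q := (n %/ k.+1).+1.
Let rho := k.+1 * q - n.

Definition multiplicity (p : {ffun mid_set k.+1 -> 'I_N}) (S : {set 'I_k.+1}) : nat :=
  oapp (fun v => p v : nat) 0 (insub S).

(* The extra [rho] on one pair makes [k.+1] divide the right-hand side of
   [common_size_eq], so that the common size of the sets is an integer. *)
Definition mid_weight p S := k.+1 * multiplicity p S + (S == pair_set) * rho.

Definition common_size p := \sum_(S : {set 'I_k.+1}) #|S|.-1 * multiplicity p S + q.

Lemma n_lt_q : n < k.+1 * q.
Proof. by rewrite /q mulnC; apply: ltn_ceil. Qed.

Lemma rho_le : rho <= k.+1.
Proof.
by rewrite /rho /q mulnS {2}(divn_eq n k.+1) mulnC; lia.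
Qed.

Lemma card_pair_set : #|pair_set| = 2.
Proof. by rewrite cards2 -val_eqE /= neq_ltn (ltnW k_gt1). Qed.

Lemma mid_weight0 p (S : {set 'I_k.+1}) :
  ~~ (1 < #|S| < k.+1) -> mid_weight p S = 0.
Proof.
move=> nmid; rewrite /mid_weight /multiplicity insubN //= muln0 add0n.
by case: eqP nmid => // ->; rewrite card_pair_set /= ltnS k_gt1.
Qed.

(** A pair has [#|S|.-1 = 1], so the correction contributes [rho] exactly once, and
    [n + rho = k.+1 * q]. *)
Lemma common_size_eq p :
  k.+1 * common_size p = n + \sum_(S : {set 'I_k.+1}) #|S|.-1 * mid_weight p S.
Proof.
have -> : \sum_(S : {set 'I_k.+1}) #|S|.-1 * mid_weight p S =
    k.+1 * (\sum_(S : {set 'I_k.+1}) #|S|.-1 * multiplicity p S) + rho.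
  rewrite big_distrr /=.
  have -> : rho = \sum_(S : {set 'I_k.+1}) #|S|.-1 * ((S == pair_set) * rho).
    rewrite (bigD1 pair_set) //= card_pair_set eqxx !mul1n big1 ?addn0 //.
    by move=> S /negbTE ->; rewrite mul0n muln0.
  rewrite -big_split /=; apply: eq_bigr => S _.
  by rewrite /mid_weight mulnDr mulnCA.
by rewrite /common_size mulnDr; have := n_lt_q; rewrite /rho; lia.
Qed.

(** Each of the [2 ^ k.+1] weights is at most [k.+1 * N.+1], as both a multiplicity below [N] and
    [rho] are controlled; [n_big] then makes [q] alone large enough. *)
Lemma common_size_big p : \sum_S mid_weight p S + 2 <= common_size p.
Proof.
apply: leq_trans (leq_addl _ _).
have wle S : mid_weight p S <= k.+1 * N.+1.
  rewrite /mid_weight mulnS addnC leq_add //.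
    by case: eqP; rewrite ?mul1n ?mul0n // rho_le.
  rewrite leq_mul2l /= /multiplicity; case: insubP => //= v _ _.
  exact: ltnW.
have : \sum_S mid_weight p S <= 2 ^ k.+1 * (k.+1 * N.+1).
  by rewrite -card_set_ord -sum_nat_const; apply: leq_sum.
rewrite -(leq_add2r 2) => /leq_trans; apply; apply: ltnW.
by rewrite -(ltn_pmul2l (ltn0Sn k)); apply: leq_ltn_trans n_big n_lt_q.
Qed.

Let weight p := completion (common_size p) (mid_weight p).

Lemma weight_inj p p' : (forall S, weight p S = weight p' S) -> p = p'.
Proof.
move=> eq_w; apply/ffunP => v; apply: val_inj; have := eq_w (val v).
rewrite /weight !completion_mid ?(valP v) // /mid_weight /multiplicity !valK /=.
by move/addIn/eqP; rewrite eqn_pmul2l // => /eqP.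
Qed.

(** Each [p] yields an excluded minor. For fixed [p], the parameters with isomorphic minors inject
    into the permutations of the [k + 1] indices, so each class is hit at most [(k.+1)!] times. *)
Lemma num_iso_excluded_ge : N ^ #|{: mid_set k.+1}| <=
  (k.+1)`! * num_iso (excluded_minor (sparse_paving_class k)) n.
Proof.
have [M MP] := fin_all_exists (fun p => exists_completion (ltnW k_gt1)
  (@mid_weight0 p) (common_size_eq p) (common_size_big p)).
rewrite -[N in N ^ _]card_ord -card_ffun /num_iso; set D := [set L | _].
apply: (card_classes_ge (@miso_equiv _ D) (h := M)) => p.
  by have [gM eM _] := MP p; rewrite inE gM eqxx.
pose g p' : {perm 'I_k.+1} :=
  odflt 1%g [pick s : {perm 'I_k.+1} |
    [forall S : {set 'I_k.+1}, weight p S == weight p' (s @: S)]].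
have gP p' : miso (M p) (M p') -> forall S, weight p S = weight p' (g p' @: S).
  have [_ _ rp] := MP p; have [_ _ rp'] := MP p'.
  move=> /(realizes_miso rp rp')[s sP]; rewrite /g; case: pickP => [t /forallP tP S|].
    exact/eqP.
  by move/(_ s)/negP; case; apply/forallP => S; apply/eqP/sP.
rewrite -card_Sn -(@card_in_imset _ _ g) ?max_card // => p1 p2.
(* A common permutation transports [weight p] to both [weight p1] and [weight p2], which therefore
   agree. *)
rewrite !inE => /gP eq1 /gP eq2 eq_g; apply: weight_inj => S.
have -> : S = g p1 @: ((g p1)^-1%g @: S).
  by rewrite -imset_comp -[LHS]imset_id; apply: eq_imset => x /=; rewrite permKV.
by rewrite -eq1 eq2 eq_g.
Qed.

End LowerBound.

(** * Comparison of the growth rates and passage to the limit *)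

Lemma excluded_dominates k : 2 < k -> exists C, forall n, C <= n ->
  0 < num_iso (excluded_minor (sparse_paving_class k)) n /\
  n * num_iso (sparse_paving_class k) n <=
    C * num_iso (excluded_minor (sparse_paving_class k)) n.
Proof.
(* [B] is chosen so that [N = n %/ B] meets the size requirement of the lower bound, using
   [N.+1 <= 2 * N]. *)
move=> k_gt2; pose B := k.+1 * (2 ^ k.+1 * (k.+1 * 2) + 2).
(* [d] exceeds the exponent of the upper bound by one, which absorbs the factor [n]. The factor
   [(2 * B) ^ d] comes from [n.+1 <= 2 * B * N], and the summand [B] forces [N] to be positive. *)
pose d := (2 ^ k).+2; exists ((k.+1)`! * (2 * B) ^ d + B) => n le_n.
set x := num_iso (excluded_minor _) n; set m := num_iso _ n.
pose N := n %/ B.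
have B_gt0 : 0 < B by rewrite /B muln_gt0 addn2.
have N_gt0 : 0 < N by rewrite /N divn_gt0 //; apply: leq_trans le_n; rewrite leq_addl.
have n_lt : n.+1 <= 2 * B * N.
  apply: leq_trans (ltn_ceil n B_gt0) _; rewrite -/N; nia.
have ge_n : k.+1 * (2 ^ k.+1 * (k.+1 * N.+1) + 2) <= n.
  apply: leq_trans (leq_trunc_div n B); rewrite -/N /B.
  rewrite [N * _]mulnC -mulnA leq_mul2l /= mulnDl leq_add //; last by rewrite leq_pmulr.
  rewrite -!mulnA !leq_mul2l; apply/orP; right; apply/orP; right; lia.
have lower := num_iso_excluded_ge (ltnW k_gt2) ge_n; rewrite -/x in lower.
have d_le : d <= #|{: mid_set k.+1}|.
  apply: leq_trans (card_mid_set k.+1); rewrite /d.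
  (* Here [k >= 3] is decisive: equality holds at 3 and the inequality fails at 2. It amounts to
     [2 ^ k + 2 <= 2 ^ (k + 1) - (k + 3)]. *)
  have : k + 5 <= 2 ^ k.
    elim: k k_gt2 {B d x m N B_gt0 N_gt0 n_lt ge_n lower le_n} => // k IH.
    rewrite leq_eqVlt => /orP[/eqP <- //|/IH]; rewrite expnS; lia.
  by rewrite expnS; lia.
have lowerd : N ^ d <= (k.+1)`! * x.
  by apply: leq_trans lower; rewrite leq_pexp2l.
split.
  have : 0 < (k.+1)`! * x by apply: leq_trans lowerd; rewrite expn_gt0 N_gt0.
  by rewrite muln_gt0 => /andP[].
have upper : m <= n.+1 ^ (2 ^ k).+1 by apply: num_iso_sparse_paving_le.
apply: (@leq_trans (n.+1 ^ d)).
  by rewrite /d expnS leq_mul.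
apply: leq_trans (_ : (2 * B * N) ^ d <= _); first by rewrite leq_exp2r.
rewrite expnMn mulnDl; apply: leq_trans (leq_addr _ _).
by rewrite -mulnA mulnCA leq_mul2l lowerd orbT.
Qed.

Import Order.TTheory GRing.Theory Num.Theory.
Import numFieldNormedType.Exports.
Local Open Scope classical_set_scope.
Local Open Scope ring_scope.

(** The distance to 1 is [m n / (m n + x n)], which is at most [m n / x n], hence at most [C / n]
    for large [n]. *)
Lemma cvg_ratio1 (R : realType) (m x : nat -> nat) (C : nat) :
  (forall n, (C <= n)%N -> (0 < x n)%N /\ (n * m n <= C * x n)%N) ->
  ((x n)%:R / (m n + x n)%:R : R) @[n --> \oo] --> (1 : R).
Proof.
move=> dom; apply/cvgrPdist_le => e e_gt0.
near=> n.
have [x_gt0 mx] : (0 < x n)%N /\ (n * m n <= C * x n)%N.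
  by apply: dom; near: n; exists C.
have n_big : C%:R / e <= n%:R by near: n; apply: nbhs_infty_ger.
have s_gt0 : 0 < (m n + x n)%:R :> R by rewrite ltr0n addn_gt0 x_gt0 orbT.
have -> : 1 - (x n)%:R / (m n + x n)%:R = (m n)%:R / (m n + x n)%:R :> R.
  by rewrite -{1}(divff (lt0r_neq0 s_gt0)) -mulrBl natrD addrK.
rewrite ger0_norm ?divr_ge0 ?ler0n // ler_pdivrMr //.
have n_gt0 : 0 < n%:R :> R by rewrite ltr0n; near: n; exists 1%N.
rewrite ler_pdivrMr // in n_big.
have mxR : n%:R * (m n)%:R <= C%:R * (x n)%:R :> R by rewrite -!natrM ler_nat.
have step : C%:R * (x n)%:R <= n%:R * e * (x n)%:R by rewrite ler_wpM2r.
have : (m n)%:R <= e * (x n)%:R.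
  by rewrite -(ler_pM2l n_gt0) mulrA; apply: le_trans step.
move=> /le_trans; apply; rewrite ler_pM2l // ler_nat; exact: leq_addl.
Unshelve. all: by end_near. Qed.

Theorem theorem1p3 (R : realType) (k : nat) (hk : (3 <= k)%N) :
  strongly_fractal R (sparse_paving_class k).
Proof.
have [C dom] := excluded_dominates hk.
exact: cvg_ratio1 dom.
Qed.
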